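(* Let $k\geq 1$, let $P\in\mathbb{Q}[X_{1},\ldots,X_{k}]$ be a polynomial of absolute degree $r$, and let $V=\{(X_{1},\ldots,X_{k})\in\mathbb{R}^{k}: P(X_{1},\ldots,X_{k})=0\}$. Let $\mathscr{T}:=V\cap\mathbb{Q}^{k}$. Let $\psi:\mathbb{R}\to\mathbb{R}$ be any function with $\psi(X)=o(X^{-kr+1})$ as $X\to\infty$. Then \[ \mathscr{T}\subseteq\mathscr{Z}^{k}_{\psi}\cap V\subseteq\overline{\mathscr{T}}, \] where $\overline{\mathscr{T}}$ denotes the Euclidean topological closure of $\mathscr{T}$ in $\mathbb{R}^{k}$.
   Context: The absolute degree of $P$ is the maximum of $j_{1}+\cdots+j_{k}$ over the monomials $aX_{1}^{j_{1}}\cdots X_{k}^{j_{k}}$ ($a\neq 0$) occurring in $P$. $\Vert t\Vert$ denotes the distance of $t\in\mathbb{R}$ to the nearest integer. For a function $\psi$, $\mathscr{Z}^{k}_{\psi}$ is the set of $\underline{\zeta}=(\zeta_{1},\ldots,\zeta_{k})\in\mathbb{R}^{k}$ such that the system \[ 0<\min_{1\leq j\leq k}\vert x_{j}\vert\leq\max_{1\leq j\leq k}\vert x_{j}\vert\leq X,\qquad \max_{1\leq j\leq k}\Vert x_{j}\zeta_{j}\Vert\leq\psi(X) \] has a solution $(x_{1},\ldots,x_{k})\in\mathbb{Z}^{k}$ for arbitrarily large $X$.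
   Formalization: The first inclusion is stated for functions ψ with ψ(X) ≥ 0 for arbitrarily large X, since it fails for eventually negative ψ whenever the set of rational points of V is nonempty; the second inclusion holds for arbitrary ψ. *)

(* Defs.v *)
From HB Require Import structures.
From mathcomp Require Import all_boot all_order all_algebra.
From mathcomp Require Import all_classical all_reals all_analysis.
(* The notations of mpoly clash with those of mathcomp-analysis. *)
From mathcomp Require Import -(notations) mpoly.
Set Implicit Arguments.
Unset Strict Implicit.
Unset Printing Implicit Defensive.
Import Order.TTheory GRing.Theory Num.Theory.
Import numFieldNormedType.Exports.
Local Open Scope classical_set_scope.
Local Open Scope ring_scope.

(* Lets little-o be taken along +oo. *)
Canonical pinfty_filter_on (R : numFieldType) :=
  FilterType (pinfty_nbhs R) _.

Definition dist_nearest_int (R : realType) (t : R) : R :=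
  inf [set `|t - n%:~R| | n in [set: int]].

(* The zero polynomial has no absolute degree: its [msize] is 0. *)
Definition has_absolute_degree (k : nat) (P : mpoly k rat) (r : nat) :
  Prop := msize P = r.+1.

Definition real_zeros (R : realType) (k : nat) (P : mpoly k rat) :
  set 'rV[R]_k :=
  [set x | mmap (@ratr R) (fun j => x ord0 j) P = 0].

Definition rational_points (R : realType) (k : nat) : set 'rV[R]_k :=
  range (fun q : 'rV[rat]_k => map_mx (@ratr R) q).

(* For k > 0, bounding the minimum (maximum) of a family indexed by 'I_k from
   below (above) is bounding each of its members. *)
Definition Zset (R : realType) (k : nat) (psi : R -> R) : set 'rV[R]_k :=
  [set zeta | forall M : R, exists2 X : R, M <= X &
    exists x : 'I_k -> int,
      [/\ forall j, 0 < `|(x j)%:~R : R|,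
          forall j, `|(x j)%:~R : R| <= X &
          forall j, dist_nearest_int ((x j)%:~R * zeta ord0 j) <= psi X]].

(* Main.v *)
Require Import Defs.
From HB Require Import structures.
From mathcomp Require Import all_boot all_order all_algebra.
From mathcomp Require Import all_classical all_reals all_analysis.
From mathcomp Require Import -(notations) mpoly.
From mathcomp Require Import ring lra.
Import Order.TTheory GRing.Theory Num.Theory.
Import numFieldNormedType.Exports.
Local Open Scope classical_set_scope.
Local Open Scope ring_scope.

(* Let zeta be in V and let x be a solution of the system for a large X, with
   y_j the integer close to x_j zeta_j. The rational point y / x is close to
   zeta, so by the local Lipschitz property |P(y / x)| is at most a constant
   times the sum of the |zeta_i - y_i / x_i|. On the other hand P(y / x) times
   d |x_1|^r ... |x_k|^r is an integer for some d depending on P only. For X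
   large this integer is smaller than 1 in absolute value, so P(y / x) = 0.
   In the other direction, a rational point solves the system with all the x_j
   equal to a common denominator of its coordinates. *)

(** The base point is fixed and the bound is a sum over coordinates, so that each [|z j - x j|] can
    later be weighed against its own denominator. *)
Definition locally_lipschitz_at (R : realType) (k : nat) (x : 'I_k -> R)
    (f : ('I_k -> R) -> R) :=
  exists2 C : R, 0 <= C & forall z, (forall j, `|z j - x j| <= 1) ->
    `|f z - f x| <= C * \sum_j `|z j - x j|.

Section Lipschitz.
Variables (R : realType) (k : nat) (x : 'I_k -> R).
Implicit Types f g : ('I_k -> R) -> R.

Lemma lipschitz_cst (c : R) : locally_lipschitz_at R k x (fun=> c).
Proof. by exists 0 => // z _; rewrite subrr normr0 mul0r. Qed.

Lemma lipschitz_coord j : locally_lipschitz_at R k x (fun z => z j).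
Proof.
exists 1 => // z _; rewrite mul1r (bigD1 j) //= lerDl.
by apply: sumr_ge0 => i _.
Qed.

Lemma lipschitzD f g : locally_lipschitz_at R k x f ->
  locally_lipschitz_at R k x g ->
  locally_lipschitz_at R k x (fun z => f z + g z).
Proof.
move=> [C C0 fC] [D D0 gD]; exists (C + D); first exact: addr_ge0.
move=> z zx; rewrite opprD addrACA mulrDl.
by apply: le_trans (ler_normD _ _) _; apply: lerD; [exact: fC | exact: gD].
Qed.

Lemma lipschitzM f g : locally_lipschitz_at R k x f ->
  locally_lipschitz_at R k x g ->
  locally_lipschitz_at R k x (fun z => f z * g z).
Proof.
move=> [C C0 fC] [D D0 gD].
(* On the unit ball the k coordinates differ by at most 1 each, so [|f x| + C * k%:R] bounds
   [|f z|]. *)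
exists ((`|f x| + C * k%:R) * D + `|g x| * C).
  by rewrite addr_ge0 ?mulr_ge0 ?addr_ge0 ?mulr_ge0 ?ler0n ?normr_ge0.
move=> z zx; set S := \sum_j _.
have S0 : 0 <= S by apply: sumr_ge0.
have Sk : S <= k%:R.
  rewrite /S -[leRHS]mulr1 -[k in k%:R]card_ord mulr_natl -sumr_const.
  by apply: ler_sum => j _; exact: zx.
have fz : `|f z| <= `|f x| + C * k%:R.
  rewrite -[f z](subrK (f x)) addrC.
  apply: le_trans (ler_normD _ _) _; rewrite lerD2l.
  by apply: le_trans (fC _ zx) _; rewrite ler_wpM2l.
have -> : f z * g z - f x * g x = f z * (g z - g x) + g x * (f z - f x).
  by ring.
rewrite mulrDl -!mulrA; apply: le_trans (ler_normD _ _) _; rewrite !normrM.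
by apply: lerD; [apply: ler_pM | apply: ler_wpM2l] => //; [exact: gD|exact: fC].
Qed.

Lemma lipschitz_mmap (P : mpoly k rat) :
  locally_lipschitz_at R k x (fun z => mmap (@ratr R) z P).
Proof.
rewrite /mmap; elim: (msupp P) => [|m s IHs].
  under [X in locally_lipschitz_at _ _ _ X]eq_fun do rewrite big_nil.
  exact: lipschitz_cst.
under [X in locally_lipschitz_at _ _ _ X]eq_fun do rewrite big_cons.
apply: lipschitzD => //; apply: lipschitzM; first exact: lipschitz_cst.
rewrite /mmap1; elim: (index_enum _) => [|j t IHt].
  under [X in locally_lipschitz_at _ _ _ X]eq_fun do rewrite big_nil.
  exact: lipschitz_cst.
under [X in locally_lipschitz_at _ _ _ X]eq_fun do rewrite big_cons.
apply: lipschitzM => //; elim: (m j) => [|n IHn].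
  under [X in locally_lipschitz_at _ _ _ X]eq_fun do rewrite expr0.
  exact: lipschitz_cst.
under [X in locally_lipschitz_at _ _ _ X]eq_fun do rewrite exprS.
by apply: lipschitzM => //; exact: lipschitz_coord.
Qed.

End Lipschitz.

Lemma mdeg_coord_le (k : nat) (m : multinom k) (j : 'I_k) : (m j <= mdeg m)%N.
Proof. by rewrite mdegE (bigD1 j) //= leq_addr. Qed.

(** The product of the denominators of the coefficients serves as [d]. The powers of the [x j] clear
    each monomial, whose exponents are at most its degree, hence at most [r]. *)
Lemma mmap_common_denominator (R : realType) (k r : nat) (P : mpoly k rat) :
  (msize P <= r.+1)%N ->
  exists2 d : nat, (0 < d)%N & forall x y : 'I_k -> int,
    (forall j, x j != 0) ->
    d%:R * (\prod_j (x j)%:~R ^+ r) *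
      mmap (@ratr R) (fun j => (y j)%:~R / (x j)%:~R) P \is a Num.int.
Proof.
move=> degP.
have {degP} : all (fun m => mdeg m <= r)%N (msupp P).
  apply/allP => m /msize_mdeg_lt mP; rewrite -ltnS.
  exact: leq_trans mP degP.
rewrite /mmap; elim: (msupp P) => [_|m s IHs /= /andP[mr /IHs[d d0 dP]]].
  by exists 1%N => // x y _; rewrite big_nil mulr0.
have [e e0 ec] : exists2 e : nat, (0 < e)%N &
    e%:R * ratr (mcoeff m P) \is a @Num.int R.
  exists `|denq (mcoeff m P)|%N; first by rewrite absz_gt0 denq_eq0.
  rewrite pmulrn gez0_abs ?denq_ge0// -[_%:~R](ratr_int R) -rmorphM/=.
  by rewrite mulrC -numqE ratr_int intr_int.
exists (e * d)%N => [|x y x0]; first by rewrite muln_gt0 e0.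
rewrite big_cons mulrDr natrM rpredD//; last first.
  by rewrite -!mulrA rpredM ?rpred_nat// mulrA dP.
have -> : e%:R * d%:R * \prod_j (x j)%:~R ^+ r * (ratr (mcoeff m P) *
    mmap1 (S:=R) (fun j => (y j)%:~R / (x j)%:~R) m) =
  (e%:R * ratr (mcoeff m P)) * d%:R *
  (\prod_j (x j)%:~R ^+ r * mmap1 (S:=R) (fun j => (y j)%:~R / (x j)%:~R) m).
  by ring.
apply: rpredM; first by rewrite rpredM ?rpred_nat.
rewrite /mmap1 -big_split/=; apply: rpred_prod => j _.
have mjr := leq_trans (mdeg_coord_le _ m j) mr.
rewrite -(subnK mjr) exprD expr_div_n -mulrA.
rewrite [X in _ * X]mulrC divfK ?expf_neq0 ?intr_eq0//.
by rewrite rpredM ?rpredX ?intr_int.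
Qed.

(* Sparing one factor of |x_i| is what compensates the division by |x_i| in
   |zeta_i - y_i / x_i| <= psi X / |x_i|, so that psi = o(X^(1 - k r)) is enough
   although the |x_i| have no lower bound tending to infinity. *)
Lemma prodrX_le (R : realType) (k r : nat) (a : 'I_k -> R) (X : R) (i : 'I_k) :
  (0 < r)%N -> (forall j, 0 <= a j <= X) ->
  \prod_j a j ^+ r <= a i * X ^+ (k * r).-1.
Proof.
case: r => // r _ aX; have X0 : 0 <= X.
  by case/andP: (aX i); exact: le_trans.
(* [r] is now one less than the original exponent: [r] factors are left at [i], and [r.+1] at each
   of the other [k.-1] indices. *)
have -> : ((k * r.+1).-1 = r + r.+1 * k.-1)%N.
  by case: k i {a aX} => [[]//|k] _; rewrite mulnC mulnS.
rewrite (bigD1 i) //= exprS -mulrA; case/andP: (aX i) => ai0 aiX.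
rewrite ler_wpM2l// exprD; apply: ler_pM.
- exact: exprn_ge0.
- by apply: prodr_ge0 => j _; case/andP: (aX j) => ? _; exact: exprn_ge0.
- by rewrite lerXn2r ?nnegrE.
rewrite exprM -[k in X in _ <= X]card_ord -(cardC1 i) -prodr_const.
by apply: ler_prod => j _; case/andP: (aX j) => ? ?;
  rewrite exprn_ge0// lerXn2r ?nnegrE.
Qed.

(** Strictness yields an integer without showing that the infimum is attained. *)
Lemma dist_nearest_int_lt (R : realType) (t e : R) :
  dist_nearest_int t < e -> exists n : int, `|t - n%:~R| < e.
Proof.
case/inf_lt; first by exists `|t - 0%:~R|, 0.
by move=> _ [n _ <-]; exists n.
Qed.

Lemma dist_nearest_int_intr (R : realType) (n : int) :
  dist_nearest_int (n%:~R : R) = 0.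
Proof.
apply/le_anti/andP; split.
  apply: ge_inf; first by exists 0 => _ [m _ <-].
  by exists n => //; rewrite subrr normr0.
by apply: lb_le_inf; [exists `|n%:~R - n%:~R|, n | move=> _ [m _ <-]].
Qed.

Theorem theorem3p2 (R : realType) (k r : nat) (P : mpoly k rat)
    (psi : R -> R)
    (V := @real_zeros R k P)
    (T := V `&` @rational_points R k)
    (k_gt0 : (0 < k)%N)
    (degP : has_absolute_degree P r)
    (psi_o : psi =o_ (+oo_R)
               (fun X : R => X ^ (- (k * r)%N%:Z + 1))) :
  ((forall M : R, exists2 X : R, M <= X & 0 <= psi X) ->
     T `<=` @Zset R k psi `&` V) /\
  @Zset R k psi `&` V `<=` closure T.
Proof.
split=> [psi_ge0 z [Vz [q _ qz]]|z [Zz Vz]].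
  split => // M.
  pose D := \prod_(j < k) denq (q ord0 j).
  have D0 : D != 0 by apply/prodf_neq0 => j _; rewrite denq_eq0.
  (* Multiplying by [D] makes every coordinate an integer, so the distances are 0 and only
     [0 <= psi X] remains to be met. *)
  have [X MX psiX] := psi_ge0 (Num.max M `|D%:~R|).
  move: MX; rewrite ge_max => /andP[MX DX].
  exists X => //; exists (fun=> D); split => // j.
    by rewrite normr_gt0 intr_eq0.
  rewrite -qz mxE (_ : D%:~R * _ = (numq (q ord0 j) *
    \prod_(i < k | i != j) denq (q ord0 i))%:~R) ?dist_nearest_int_intr//.
  rewrite -ratr_int -rmorphM /= -[RHS](ratr_int R); congr ratr.
  by rewrite /D (bigD1 j)//= !intrM numqE; ring.
(* A nonzero constant has no zeros. *)
have r_gt0 : (0 < r)%N.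
  rewrite lt0n; apply/negP => /eqP r0.
  move: degP; rewrite r0 => /eqP/msize_poly1P[c c0 Pc].
  move: Vz; rewrite /V /real_zeros /= Pc mmapC => /eqP.
  by rewrite fmorph_eq0 (negPf c0).
have [C C0 lipP] := lipschitz_mmap _ _ (fun j => z ord0 j) P.
have [d d0 dP] := mmap_common_denominator R _ _ _ (eq_leq degP).
move=> B /nbhs_ballP[e /= e0 zeB].
(* The three bounds keep the rational point in the domain of the Lipschitz bound, put it in the
   given ball, and force the final integer below 1. *)
pose de := Num.min (Num.min 1 (e / 2)) (2 * (C * d%:R * k%:R + 1))^-1.
have CDk0 : 0 <= C * d%:R * k%:R by rewrite !mulr_ge0.
have de0 : 0 < de by rewrite !lt_min ltr01 divr_gt0//= invr_gt0; lra.
have [de1 dee deC] : [/\ de <= 1, de < e & C * d%:R * k%:R * de < 1].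
  have : de <= de by [].
  rewrite {2}/de !le_min => /andP[/andP[-> dee] deC]; split => //; first by lra.
  have : de * (2 * (C * d%:R * k%:R + 1)) <= 1.
    by rewrite -ler_pdivlMr ?div1r//; lra.
  by lra.
have de2 : 0 < de / 2 by rewrite divr_gt0.
(* Half of [de] is used so that the bound on [psi X] becomes strict. *)
have [M [_ psiM]] : \forall X \near +oo_R,
    `|psi X| <= de / 2 * `|X ^ (- (k * r)%N%:Z + 1)|.
  by move/eqoP: psi_o; exact.
have [X MX [x [x_neq0 xX xz]]] := Zz (Num.max (M + 1) 1).
move: MX; rewrite ge_max => /andP[MX X1].
have X0 : 0 < X by exact: lt_le_trans X1.
pose Y := X ^+ (k * r).-1.
have Y1 : 1 <= Y by exact: exprn_ege1.
have psiY : psi X < de / Y.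
  have MX' : M < X by lra.
  apply: le_lt_trans (ler_norm _) _; apply: le_lt_trans (psiM X MX') _.
  have -> : X ^ (- (k * r)%N%:Z + 1) = Y^-1.
    rewrite /Y; case: (k * r)%N (muln_gt0 k r) => [|n _].
      by rewrite k_gt0 r_gt0.
    by rewrite -[in LHS]addn1 PoszD opprD subrK -exprnN.
  rewrite ger0_norm ?invr_ge0 ?(le_trans ler01)//.
  rewrite ltr_pM2r ?invr_gt0 ?(lt_le_trans ltr01)//.
  by lra.
have x0 j : x j != 0 by move: (x_neq0 j); rewrite normr_gt0 intr_eq0.
have /fin_all_exists[y yP] j :
    exists n : int, `|(x j)%:~R * z ord0 j - n%:~R| < de / Y.
  by apply: dist_nearest_int_lt; exact: le_lt_trans (xz j) psiY.
pose w j : R := (y j)%:~R / (x j)%:~R.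
(* The factor [|x j|] is kept, to be matched with the one spared in [prodrX_le]. *)
have wz j : `|w j - z ord0 j| * `|(x j)%:~R| < de / Y.
  by rewrite -normrM mulrBl divfK ?intr_eq0// distrC mulrC.
have wz_de j : `|w j - z ord0 j| < de.
  apply: le_lt_trans (lt_le_trans (wz j) _).
    by rewrite ler_peMr// norm_intr_ge1// intr_eq0.
  by rewrite ler_pdivrMr ?(lt_le_trans ltr01)// ler_peMr// ltW.
exists (\row_j w j); split; last first.
  apply: zeB; split=> // i j; rewrite mxE (ord1 i) /ball/= distrC.
  exact: lt_trans dee.
split; last first.
  exists (\row_j ((y j)%:Q / (x j)%:Q)) => //.
  by apply/rowP => j; rewrite !mxE fmorph_div/= !ratr_int.
rewrite /V /real_zeros /= (_ : (fun j => _) = w); last first.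
  by apply/funext => j; rewrite mxE.
pose N : R := d%:R * (\prod_j (x j)%:~R ^+ r) * mmap (@ratr R) w P.
have N0 : N = 0.
  (* A nonzero integer has absolute value at least 1, whereas [|N|] is at most [C * d * k * de]. *)
  apply/eqP; rewrite -[_ == _]negbK; apply/negP => NN0.
  have := norm_intr_ge1 (dP _ y x0) NN0; apply/negP; rewrite -ltNge.
  apply: le_lt_trans deC.
  have PwC : `|mmap (@ratr R) w P| <= C * \sum_j `|w j - z ord0 j|.
    have := lipP w; rewrite Vz subr0; apply => j.
    exact: le_trans (ltW (wz_de j)) de1.
  rewrite !normrM normr_nat -mulrA [C * _]mulrC -!mulrA ler_wpM2l//.
  rewrite normr_prod.
  apply: le_trans (ler_wpM2l _ PwC) _; first exact: prodr_ge0.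
  rewrite mulrCA ler_wpM2l// mulr_sumr.
  rewrite -[k in k%:R]card_ord mulr_natl -sumr_const; apply: ler_sum => i _.
  (* By [wz], each of the [k] terms is then at most [de]. *)
  apply: le_trans (_ : `|(x i)%:~R| * Y * `|w i - z ord0 i| <= _).
    rewrite ler_wpM2r// /Y; under eq_bigr do rewrite normrX.
    by apply: prodrX_le => // j; rewrite normr_ge0 xX.
  by rewrite mulrAC -ler_pdivlMr ?(lt_le_trans ltr01)// mulrC ltW.
move/eqP: N0; rewrite !mulf_eq0 pnatr_eq0 eqn0Ngt d0/= => /orP[|/eqP//].
by move=> /prodf_eq0[j _]; rewrite expf_eq0 intr_eq0 (negPf (x0 j)) andbF.
Qed.
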